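(* For every triple of positive integers $(k,s,n)$ and for every $\varepsilon\in[0,1]$, the sample mean $\bar{\boldsymbol X}_n := \frac1n\sum_{i=1}^n \boldsymbol X_i$ satisfies $$R_{\mathrm{TV}}^{\mathrm{AC}}(n,\varepsilon,\Delta_s^{k-1},\bar{\boldsymbol X}_n)\le (s/n)^{1/2}+2\varepsilon,$$ $$R_{\mathrm{H}}^{\mathrm{AC}}(n,\varepsilon,\Delta_s^{k-1},\bar{\boldsymbol X}_n)\le (s/n)^{1/2}+2\,\varepsilon^{1/2},$$ $$R_{\mathbb L^2}^{\mathrm{AC}}(n,\varepsilon,\Delta_s^{k-1},\bar{\boldsymbol X}_n)\le (1/n)^{1/2}+\sqrt2\,\varepsilon.$$
   Context: The probability simplex is $\Delta^{k-1}=\{\boldsymbol v\in\mathbb R_+^k: v_1+\dots+v_k=1\}$, and $\Delta_s^{k-1}$ is the set of all $\boldsymbol v\in\Delta^{k-1}$ having at most $s$ non-zero entries. Distances on $\Delta^{k-1}$: $d_{\mathrm{TV}}(\boldsymbol\theta,\boldsymbol\theta')=\frac12\sum_{j=1}^k|\theta_j-\theta'_j|$; $d_{\mathrm H}(\boldsymbol\theta,\boldsymbol\theta')=\big(\sum_{j=1}^k(\sqrt{\theta_j}-\sqrt{\theta'_j})^2\big)^{1/2}$; $d_{\mathbb L^2}(\boldsymbol\theta,\boldsymbol\theta')=\big(\sum_{j=1}^k(\theta_j-\theta'_j)^2\big)^{1/2}$. Adversarial contamination (AC): for $\boldsymbol\theta^*\in\Delta^{k-1}$, $\mathcal M_n^{\mathrm{AC}}(\varepsilon,\boldsymbol\theta^*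 )$ is the set of all joint distributions of random vectors $(\boldsymbol X_1,\dots,\boldsymbol X_n)$ with values in $(\Delta^{k-1})^n$ generated as follows. First, $\boldsymbol Y_1,\dots,\boldsymbol Y_n$ are drawn i.i.d. from some probability distribution $\boldsymbol P$ on $\Delta^{k-1}$ (the reference distribution, otherwise arbitrary) with mean $\boldsymbol\theta^*$. Then an adversary having access to $\boldsymbol Y_1,\dots,\boldsymbol Y_n$ chooses a random set $\hat O\subset\{1,\dots,n\}$ (possibly depending on the $\boldsymbol Y_i$) of deterministic cardinality at most $n\varepsilon$ and arbitrarily modifies the points $\boldsymbol Y_i$, $i\in\hat O$, within $\Delta^{k-1}$; thus $\boldsymbol X_i=\boldsymbol Y_i$ for all $i\notin\hat O$. Worst-case risk: for an estimator $\hat{\boldsymbol\theta}_n$ (a function of $\boldsymbol X_1,\dots,\boldsymbol X_n$), a set $\Theta\subset\Delta^{k-1}$ and $\square\in\{\mathrm{TV},\mathrm H,\mathbb L^2\}$, $$R_\square^{\mathrm{AC}}(n,\varepsilon,\Theta,\hat{\boldsymbol\theta}_n)=\sup_{\boldsymbol\theta^*\in\Theta}\ \sup_{\boldsymbol P_n\in\mathcal M_n^{\mathrm{AC}}(\varepsilon,\boldsymbol\theta^* )}\mathbf E_{\boldsymbol P_n}[d_\square(\hat{\boldsymbol\theta}_n,\boldsymbol\theta^* )].$$ *)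

(* Defs.v *)
From HB Require Import structures.
From mathcomp Require Import all_boot all_order all_algebra.
From mathcomp Require Import all_classical all_reals all_analysis.

Set Implicit Arguments.
Unset Strict Implicit.
Unset Printing Implicit Defensive.

Import Order.TTheory GRing.Theory Num.Theory.
Import numFieldNormedType.Exports.

Local Open Scope classical_set_scope.
Local Open Scope ring_scope.

(* Vectors of R^k are [k.-tuple R] and samples of n such vectors are
   [n.-tuple (k.-tuple R)]: the library equips tuples over a measurable type
   with the product sigma-algebra, here the Borel sigma-algebra. *)

Section Simplex.
Context {R : realType} {k : nat}.
Implicit Types u v : k.-tuple R.

Definition simplex : set (k.-tuple R) :=
  [set v | (forall j, 0 <= tnth v j) /\ \sum_(j < k) tnth v j = 1].

Definition sparse_simplex (s : nat) : set (k.-tuple R) :=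
  [set v | simplex v /\ (#|[pred j : 'I_k | tnth v j != 0%R]| <= s)%N].

Definition dTV u v : R := 2^-1 * \sum_(j < k) `|tnth u j - tnth v j|.

Definition dH u v : R :=
  Num.sqrt (\sum_(j < k) (Num.sqrt (tnth u j) - Num.sqrt (tnth v j)) ^+ 2).

Definition dL2 u v : R :=
  Num.sqrt (\sum_(j < k) (tnth u j - tnth v j) ^+ 2).

Definition sample_mean (n : nat) (x : n.-tuple (k.-tuple R)) : k.-tuple R :=
  [tuple n%:R^-1 * \sum_(i < n) tnth (tnth x i) j | j < k].

End Simplex.

Section Iid.
Local Open Scope ereal_scope.
Context {R : realType} {d d' : measure_display} {T : measurableType d}
  {E : measurableType d'} (P : probability T R) {n : nat}.
Implicit Type Y : {RV P >-> n.-tuple E}.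

Definition mutually_independent Y : Prop :=
  forall (J : {set 'I_n}) (A : 'I_n -> set E),
    (forall i, measurable (A i)) ->
    P [set t | forall i, i \in J -> A i (tnth (Y t) i)] =
    \prod_(i in J) P [set t | A i (tnth (Y t) i)].

Definition iid (Q : probability E R) Y : Prop :=
  mutually_independent Y /\
  forall i (A : set E), measurable A -> P [set t | A (tnth (Y t) i)] = Q A.

End Iid.

(* [Q] is a distribution on the simplex, viewed as a distribution on R^k that
   gives the simplex mass 1, with mean [theta]. *)
Definition reference_distribution {R : realType} {k : nat}
    (theta : k.-tuple R) (Q : probability (k.-tuple R) R) : Prop :=
  Q simplex = 1%E /\
  forall j : 'I_k, ('E_Q[fun v => tnth v j] = (tnth theta j)%:E)%E.

(* The adversary is described by the joint behaviour of the clean sample [Y],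
   the corrupted set [O] and the corrupted sample [X] on a common probability
   space: no restriction is put on how [O] and [X] depend on [Y] or on
   additional randomness.  The number [o] of corrupted points does not depend
   on the outcome [t]. *)
Definition ac_contamination {R : realType} {d : measure_display}
    {T : measurableType d} (P : probability T R) {n k : nat} (eps : R)
    (Y X : {RV P >-> n.-tuple (k.-tuple R)}) (O : T -> {set 'I_n}) : Prop :=
  [/\ forall t i, simplex (tnth (Y t) i) /\ simplex (tnth (X t) i),
      forall i, measurable [set t | i \in O t],
      exists2 o : nat, o%:R <= n%:R * eps & forall t, #|O t| = o
    & forall t i, i \notin O t -> tnth (X t) i = tnth (Y t) i].

(* [Pn] is compared with the law of [X] on measurable sets only, since a
   [probability] is a function on arbitrary sets. *)
Definition AC_model {R : realType} {k : nat} (n : nat) (eps : R)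
    (theta : k.-tuple R) : set (probability (n.-tuple (k.-tuple R)) R) :=
  [set Pn | exists (d : measure_display) (T : measurableType d)
      (P : probability T R) (Q : probability (k.-tuple R) R)
      (Y X : {RV P >-> n.-tuple (k.-tuple R)}) (O : T -> {set 'I_n}),
    [/\ reference_distribution theta Q,
        iid Q Y,
        ac_contamination eps Y X O
      & forall B, measurable B -> Pn B = distribution P X B]].

Arguments AC_model {R k} n eps theta.

Definition AC_risk {R : realType} {k : nat}
    (dist : k.-tuple R -> k.-tuple R -> R) (n : nat) (eps : R)
    (Theta : set (k.-tuple R)) (est : n.-tuple (k.-tuple R) -> k.-tuple R)
    : \bar R :=
  ereal_sup [set ereal_sup [set ('E_Pn[fun x => dist (est x) theta])%E
                           | Pn in AC_model n eps theta]
            | theta in Theta].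

Arguments AC_risk {R k} dist n eps Theta est.

(* Main.v *)
From HB Require Import structures.
Require Import Defs.
From mathcomp Require Import all_boot all_order all_algebra.
From mathcomp Require Import all_classical all_reals all_analysis.
From mathcomp Require Import measurable_realfun.
From mathcomp Require Import ring lra.

Set Implicit Arguments.
Unset Strict Implicit.
Unset Printing Implicit Defensive.

Import Order.TTheory GRing.Theory Num.Theory.
Import numFieldNormedType.Exports.

Local Open Scope classical_set_scope.
Local Open Scope ring_scope.

(** Write [xbar] and [ybar] for the means of the corrupted and of the clean
    sample.  By the triangle inequality the loss of [xbar] is at most the
    distance from [xbar] to [ybar] plus the loss of [ybar].

    The first term is controlled on every outcome.  At most [n * eps] points
    differ, so [xbar - ybar] is a difference [a - b] of two nonnegative vectors
    of total mass at most [eps] each ([mean_split]).  This gives [eps] in total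
    variation and [sqrt 2 * eps] in Euclidean norm; in Hellinger distance,
    [(sqrt x - sqrt y)^2 <= |x - y|] gives [sqrt (2 * eps)].

    For the second term, independence makes the cross terms of
    [E (ybar_j - theta_j)^2] vanish, and a variable with values in [0, 1] has
    variance at most its mean, so this expectation is at most [theta_j / n]
    ([iid_mean_square_error]), while [E ybar_j = theta_j].  It remains to
    bound each loss by an expression linear in the [(ybar_j - theta_j)^2] and
    the [ybar_j].  The inequality [t <= (c + t^2 / c) / 2] does this: with [c]
    the size aimed at it plays the role of Jensen and Cauchy-Schwarz together,
    and no expectation of a square root is ever estimated.  Coordinates outside
    the support of [theta] contribute only through [ybar_j], whose expectation
    is zero there.  On the support, which has at most [s] elements, each term of
    the squared Hellinger distance is at most [(ybar_j - theta_j)^2 / theta_j],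
    of expectation at most [1 / n], and total variation applies the inequality
    once per coordinate; both give the rate [sqrt (s / n)] ([dH_sparse_le],
    [dTV_sparse_le]).  In Euclidean norm the variances sum to at most [1 / n]
    ([dL2_le]). *)

(** * Expectations under an i.i.d. sample *)

Lemma bounded_integrable {R : realType} (d : measure_display)
    (T : measurableType d) (P : probability T R) (f : T -> R) (M : R) :
  measurable_fun setT f -> (forall t, `|f t| <= M) ->
  P.-integrable setT (EFin \o f).
Proof.
move=> mf fM; apply: measurable_bounded_integrable => //.
  by rewrite ltey_eq fin_num_measure.
exists M; split; first exact: num_real.
by move=> x Mx t _ /=; exact: le_trans (fM t) (ltW Mx).
Qed.

Lemma integral_probability_cst {R : realType} (d : measure_display)
    (T : measurableType d) (P : probability T R) (c : R) :
  (\int[P]_t c%:E = c%:E)%E.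
Proof. by have := expectation_cst P c; rewrite unlock. Qed.

Section IidMean.
Context {R : realType} {d d' : measure_display} {T : measurableType d}
  {E : measurableType d'} (P : probability T R) (n : nat)
  (Q : probability E R) (Y : {RV P >-> n.-tuple E}).
Hypothesis YQ : iid Q Y.

Lemma measurable_sample_coord i : measurable_fun setT (fun t => tnth (Y t) i).
Proof.
exact: (measurableT_comp (measurable_tnth i) (measurable_funPT Y)).
Qed.

Definition sample_coord i t : E := tnth (Y t) i.

Definition sample_pair i i' t : E * E := (tnth (Y t) i, tnth (Y t) i').

HB.instance Definition _ i := isMeasurableFun.Build _ _ _ _
  (sample_coord i) (measurable_sample_coord i).

HB.instance Definition _ i i' := isMeasurableFun.Build _ _ _ _
  (sample_pair i i')
  (measurable_fun_pair (measurable_sample_coord i) (measurable_sample_coord i')).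

(** Independence is assumed as a product rule on rectangles; a product measure
    is determined by its values there, so two distinct coordinates have law
    [Q \x Q] and Fubini becomes available. *)
Lemma iid_pair_law i i' (B : set (E * E)) : i != i' -> measurable B ->
  distribution P (sample_pair i i') B = (Q \x Q)%E B.
Proof.
move=> ii' mB; have [indY lawY] := YQ; apply/esym.
apply: (product_measure_unique (m' := distribution P (sample_pair i i'))) => // A A' mA mA'.
(* The event that the pair lies in [A `*` A'] only constrains the two
   coordinates [i] and [i'] of the sample. *)
pose F k := if k == i then A else A'.
have mF k : measurable (F k) by rewrite /F; case: ifP.
have := indY (i |: [set i'])%SET F mF.
rewrite big_setU1 ?inE //= big_set1 /F eqxx eq_sym (negbTE ii') !lawY // => <-.
congr (P _); apply/seteqP; split => t /=.
  by move=> [At A't] k; rewrite !inE => /orP[] /eqP ->; rewrite ?eqxx // eq_sym (negbTE ii').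
by move=> At; split; [have := At i|have := At i'];
  rewrite !inE eqxx ?orbT => /(_ isT); rewrite // eq_sym (negbTE ii').
Qed.

Section Statistic.
Variables (h : E -> R) (M : R).
Hypotheses (mh : measurable_fun setT h).
Hypothesis hM : forall i t, `|h (tnth (Y t) i)| <= M.

Let mhY i : measurable_fun setT (fun t => h (tnth (Y t) i)).
Proof. exact: measurableT_comp mh (measurable_sample_coord i). Qed.

Let ihY i : P.-integrable setT (fun t => (h (tnth (Y t) i))%:E).
Proof. exact: (bounded_integrable P (mhY i) (hM i)). Qed.

Let mhE : measurable_fun [set: E] (EFin \o h).
Proof. exact/measurable_EFinP. Qed.

Lemma iid_marginal_integral (f : E -> \bar R) i :
  (\int[distribution P (sample_coord i)]_y f y = \int[Q]_y f y)%E.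
Proof.
by have [_ lawY] := YQ; apply: eq_measure_integral => A mA _; exact: lawY.
Qed.

(** A bound on [h] along the sample suffices: [h] may be unbounded off the
    values taken by [Y], and its integrability under [Q] is inherited from that
    of [h] at a coordinate of [Y]. *)
Lemma iid_integrable (i : 'I_n) : Q.-integrable setT (EFin \o h).
Proof.
apply/integrableP; split=> //; rewrite -(iid_marginal_integral _ i).
rewrite ge0_integral_distribution //; last exact: measurableT_comp.
by have /integrableP[] := ihY i.
Qed.

Lemma iid_expectation i :
  (\int[P]_t (h (tnth (Y t) i))%:E = \int[Q]_y (h y)%:E)%E.
Proof. by rewrite -(iid_marginal_integral _ i) integral_distribution //; exact: ihY. Qed.

Lemma iid_expectationM i i' : i != i' ->
  (\int[P]_t (h (tnth (Y t) i) * h (tnth (Y t) i'))%:E =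
   \int[Q]_y (h y)%:E * \int[Q]_y (h y)%:E)%E.
Proof.
move=> ii'.
pose g (z : E * E) := h z.1 * h z.2.
have mg : measurable_fun [set: E * E] (EFin \o g).
  apply/measurable_EFinP; apply: measurable_funM.
    exact: measurableT_comp mh measurable_fst.
  exact: measurableT_comp mh measurable_snd.
have iP : P.-integrable setT (EFin \o g \o sample_pair i i').
  apply: (bounded_integrable P (f := g \o sample_pair i i') (M := M * M)).
    by apply: measurable_funM; exact: mhY.
  by move=> t; rewrite /g /= normrM ler_pM.
have law (f : E * E -> \bar R) :
    (\int[Q \x Q]_z f z = \int[distribution P (sample_pair i i')]_z f z)%E.
  by apply: eq_measure_integral => A mA _; exact/esym/iid_pair_law.
have iQ : (Q \x Q)%E.-integrable setT (EFin \o g).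
  apply/integrableP; split=> //; rewrite law.
  rewrite ge0_integral_distribution //; last exact: measurableT_comp.
  by have /integrableP[] := iP.
transitivity (\int[P]_t ((EFin \o g \o sample_pair i i') t))%E; first by [].
rewrite -integral_distribution // -law -(integral12_prod_meas1 iQ).
have ih := iid_integrable i.
have Qfin : (\int[Q]_y (h y)%:E)%E \is a fin_num by exact: integrable_fin_num ih.
under eq_integral => x _.
  rewrite /fubini_F /= /g /=.
  under eq_integral do rewrite EFinM.
  rewrite integralZl //.
  over.
by rewrite -(fineK Qfin) integralZr // fineK.
Qed.
End Statistic.
End IidMean.

Section MeanSquare.
Context {R : realType} {d d' : measure_display} {T : measurableType d}
  {E : measurableType d'} (P : probability T R) (n : nat)
  (Q : probability E R) (Y : {RV P >-> n.-tuple E}).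
Hypothesis YQ : iid Q Y.
Variables (h : E -> R) (m : R).
Hypotheses (mh : measurable_fun setT h) (hm : ('E_Q[h] = m%:E)%E).
Hypothesis h01 : forall i t, 0 <= h (tnth (Y t) i) <= 1.

Let mhY i : measurable_fun setT (fun t => h (tnth (Y t) i)).
Proof. exact: measurableT_comp mh (measurable_sample_coord Y i). Qed.

Let hle1 i t : `|h (tnth (Y t) i)| <= 1.
Proof. by have /andP[h0 h1] := h01 i t; rewrite ger0_norm. Qed.

Let ihY i : P.-integrable setT (EFin \o (fun t => (h (tnth (Y t) i)))).
Proof. exact: (bounded_integrable P (mhY i) (hle1 i)). Qed.

Let EhY i : (\int[P]_t (h (tnth (Y t) i))%:E = m%:E)%E.
Proof. by rewrite (iid_expectation YQ mh hle1) -hm unlock. Qed.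

Lemma iid_mean_expectation : (0 < n)%N ->
  (\int[P]_t (n%:R^-1 * \sum_(i < n) h (tnth (Y t) i))%:E = m%:E)%E.
Proof.
move=> n0; have n0' : n%:R != 0 :> R by rewrite pnatr_eq0 -lt0n.
under eq_integral do rewrite EFinM -sumEFin.
rewrite integralZl //; last by apply: integrable_sum => // i _; exact: ihY.
rewrite integral_sum //.
rewrite (eq_bigr (fun=> m%:E)) => [|i _]; last exact: EhY.
rewrite sumEFin sumr_const card_ord -EFinM -[m *+ n]mulr_natr.
by congr (_%:E); field.
Qed.

Let z y := h y - m.

Let mz : measurable_fun setT z.
Proof. exact: measurable_funB. Qed.

Let zle i t : `|z (tnth (Y t) i)| <= 1 + `|m|.
Proof. by rewrite (le_trans (ler_normB _ _)) // lerD2r. Qed.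

Let izz i i' :
  P.-integrable setT (fun t => (z (tnth (Y t) i) * z (tnth (Y t) i'))%:E).
Proof.
apply: (bounded_integrable P (f := fun t => z (tnth (Y t) i) * z (tnth (Y t) i'))
  (M := (1 + `|m|) * (1 + `|m|))).
  apply: measurable_funM; exact: measurableT_comp mz (measurable_sample_coord Y _).
by move=> t; rewrite normrM ler_pM.
Qed.

Lemma iid_centered_cross i i' : i != i' ->
  (\int[P]_t (z (tnth (Y t) i) * z (tnth (Y t) i'))%:E = 0)%E.
Proof.
move=> ii'; rewrite (iid_expectationM YQ mz zle ii') /z.
have ih := iid_integrable YQ mh hle1 i.
under eq_integral do rewrite EFinB.
rewrite integralB_EFin //; last first.
  exact: finite_measure_integrable_cst.
rewrite [X in (X - _)%E](_ : _ = m%:E); last by rewrite -hm unlock.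
by rewrite integral_probability_cst subee // mul0e.
Qed.

(** Since [h] is at most one along the sample, [h^2 <= h]; hence the variance is
    at most [m - m^2 <= m]. *)
Lemma iid_centered_square i :
  (\int[P]_t (z (tnth (Y t) i) * z (tnth (Y t) i))%:E <= m%:E)%E.
Proof.
have iZ : P.-integrable setT
    (EFin \o (fun t => (1 - 2 * m) * h (tnth (Y t) i))).
  by have := integrableZl measurableT (1 - 2 * m) (ihY i).
have iC : P.-integrable setT (EFin \o cst (m ^+ 2)).
  exact: finite_measure_integrable_cst.
apply: (@le_trans _ _
  (\int[P]_t ((1 - 2 * m) * h (tnth (Y t) i))%:E + \int[P]_t (m ^+ 2)%:E)%E).
  rewrite -integralD_EFin //; apply: le_integral => //.
    exact: integrableD.
  move=> t _ /=; rewrite lee_fin /z.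
  have /andP[h0 h1] := h01 i t; nra.
under eq_integral do rewrite EFinM.
rewrite integralZl //; last exact: ihY.
rewrite [X in (_ * X)%E](EhY i) integral_probability_cst.
rewrite -EFinM -EFinD lee_fin; nra.
Qed.

(** In the expansion of the square into [n^2] products, only the [n] diagonal
    ones survive, each with expectation at most [m]. *)
Lemma iid_mean_square_error : (0 < n)%N ->
  (\int[P]_t ((n%:R^-1 * \sum_(i < n) h (tnth (Y t) i) - m) ^+ 2)%:E
     <= (m / n%:R)%:E)%E.
Proof.
move=> n0; have n0' : n%:R != 0 :> R by rewrite pnatr_eq0 -lt0n.
have sqE t : ((n%:R^-1 * \sum_(i < n) h (tnth (Y t) i) - m) ^+ 2)%:E =
   ((n%:R^-1 ^+ 2)%:E * \sum_(i < n) \sum_(i' < n)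
       (z (tnth (Y t) i) * z (tnth (Y t) i'))%:E)%E.
  rewrite (eq_bigr (fun i => (z (tnth (Y t) i) * \sum_(i' < n) z (tnth (Y t) i'))%:E)); last first.
    by move=> i _; rewrite sumEFin -mulr_sumr.
  rewrite sumEFin -mulr_suml -EFinM; congr (_%:E).
  rewrite /z sumrB sumr_const card_ord -mulr_natr; field.
  by rewrite n0'.
under eq_integral do rewrite sqE.
rewrite integralZl //; last first.
  by apply: integrable_sum => // i _; apply: integrable_sum.
rewrite integral_sum //; last by move=> i; apply: integrable_sum.
apply: (@le_trans _ _ ((n%:R^-1 ^+ 2)%:E * \sum_(i < n) m%:E)%E).
  apply: lee_wpmul2l; first by rewrite lee_fin sqr_ge0.
  apply: lee_sum => i _; rewrite integral_sum // (bigD1 i) //= big1 => [|i' ii'].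
    by rewrite adde0 iid_centered_square.
  by rewrite iid_centered_cross // eq_sym.
rewrite sumEFin sumr_const card_ord -EFinM lee_fin -[m *+ n]mulr_natr.
by rewrite [leLHS](_ : _ = m / n%:R) //; field.
Qed.
End MeanSquare.

(** * Elementary inequalities and triangle inequalities *)

Section RealInequalities.
Context {R : realType} (k : nat).
Implicit Types (f g : 'I_k -> R).

Lemma ler_sqrt_sqr (x y : R) : 0 <= y -> x <= y ^+ 2 -> Num.sqrt x <= y.
Proof. by move=> y0 xy; rewrite -(ger0_norm y0) -sqrtr_sqr ler_wsqrtr. Qed.

(** With [u] and [v] the two norms, each product [f j * g j] is at most half of
    [f j ^+ 2 * v / u + g j ^+ 2 * u / v], and these terms sum to [u * v].  The
    weights require [u] and [v] to be nonzero. *)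
Lemma cauchy_schwarz_sum f g :
  \sum_j f j * g j <= Num.sqrt (\sum_j f j ^+ 2) * Num.sqrt (\sum_j g j ^+ 2).
Proof.
set F := \sum_j f j ^+ 2; set G := \sum_j g j ^+ 2.
have F0 : 0 <= F by apply: sumr_ge0 => j _; exact: sqr_ge0.
have G0 : 0 <= G by apply: sumr_ge0 => j _; exact: sqr_ge0.
have zero h1 h2 : \sum_j h1 j ^+ 2 = 0 -> \sum_(j < k) h1 j * h2 j = 0 :> R.
  move=> /eqP; rewrite psumr_eq0 => [/allP h0|j _]; last exact: sqr_ge0.
  rewrite big1 // => j _.
  have := h0 j; rewrite mem_index_enum => /(_ isT) /=.
  by rewrite sqrf_eq0 => /eqP ->; rewrite mul0r.
have [/eqP F00|Fn] := boolP (F == 0).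
  by rewrite zero // mulr_ge0.
have [/eqP G00|Gn] := boolP (G == 0).
  by under eq_bigr do rewrite mulrC; rewrite zero // mulr_ge0.
have u0 : 0 < Num.sqrt F by rewrite sqrtr_gt0 lt0r Fn.
have v0 : 0 < Num.sqrt G by rewrite sqrtr_gt0 lt0r Gn.
have uE := sqr_sqrtr F0; have vE := sqr_sqrtr G0.
set u := Num.sqrt F in u0 uE *; set v := Num.sqrt G in v0 vE *.
apply: (@le_trans _ _
  (\sum_j (f j ^+ 2 * (2^-1 * v / u) + g j ^+ 2 * (2^-1 * u / v)))).
  apply: ler_sum => j _; rewrite -subr_ge0.
  rewrite [leRHS](_ : _ = 2^-1 * (u * v)^-1 * (f j * v - g j * u) ^+ 2).
    by rewrite mulr_ge0 ?sqr_ge0 // mulr_ge0 // invr_ge0 mulr_ge0 // ltW.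
  by field; rewrite !gt_eqF.
rewrite big_split /= -!mulr_suml -/F -/G -uE -vE.
rewrite [leLHS](_ : _ = u * v) //; field; by rewrite !gt_eqF.
Qed.

Lemma sqrt_sum_sqrD f g :
  Num.sqrt (\sum_j (f j + g j) ^+ 2)
    <= Num.sqrt (\sum_j f j ^+ 2) + Num.sqrt (\sum_j g j ^+ 2).
Proof.
apply: ler_sqrt_sqr; first by rewrite addr_ge0 ?sqrtr_ge0.
rewrite sqrrD !sqr_sqrtr; try by apply: sumr_ge0 => j _; exact: sqr_ge0.
under eq_bigr do rewrite sqrrD.
rewrite !big_split /= lerD2r lerD2l.
by rewrite mulr2n lerD // cauchy_schwarz_sum.
Qed.

(** This linearises a distance in terms of its square; it is sharp at
    [x = c], so [c] is taken to be the bound wanted on the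
    expectation of [x]. *)
Lemma le_half_sqr (c x : R) : 0 < c -> x <= 2^-1 * (c + x ^+ 2 / c).
Proof.
move=> c0; rewrite -subr_ge0.
rewrite [leRHS](_ : _ = 2^-1 * c^-1 * (x - c) ^+ 2).
  by rewrite mulr_ge0 ?sqr_ge0 // mulr_ge0 // invr_ge0 ltW.
by field; rewrite gt_eqF.
Qed.

Lemma sqr_sub_sqrt (x y : R) : 0 <= x -> 0 <= y ->
  (Num.sqrt x - Num.sqrt y) ^+ 2 <= `|x - y|.
Proof.
move=> x0 y0; rewrite -{2}(sqr_sqrtr x0) -{2}(sqr_sqrtr y0) subr_sqr normrM.
rewrite -[leLHS]real_normK ?num_real // expr2 ler_wpM2l // (le_trans (ler_normB _ _)) //.
by rewrite [leRHS]ger0_norm ?addr_ge0 // !ger0_norm.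
Qed.

(** Sharper than [sqr_sub_sqrt] when [x] is close to [y]: from
    [x - y = (sqrt x - sqrt y) (sqrt x + sqrt y)], where the last factor is at
    least [sqrt y]. *)
Lemma sqr_sub_sqrt_pos (x y : R) : 0 <= x -> 0 < y ->
  (Num.sqrt x - Num.sqrt y) ^+ 2 <= (x - y) ^+ 2 / y.
Proof.
move=> x0 y0; have sy0 : 0 < Num.sqrt y by rewrite sqrtr_gt0.
rewrite ler_pdivlMr // -{2}(sqr_sqrtr x0) -{2 3}(sqr_sqrtr (ltW y0)).
rewrite subr_sqr exprMn ler_wpM2l ?sqr_ge0 // ler_sqr ?nnegrE ?addr_ge0 //.
by rewrite lerDr.
Qed.
End RealInequalities.

Section Triangle.
Context {R : realType} {k : nat}.
Implicit Types u v w : k.-tuple R.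

Lemma dTV_triangle u v w : dTV u w <= dTV u v + dTV v w.
Proof.
rewrite -mulrDr ler_wpM2l ?invr_ge0 // -big_split; apply: ler_sum => j _ /=.
exact: ler_distD.
Qed.

Lemma dL2_triangle u v w : dL2 u w <= dL2 u v + dL2 v w.
Proof.
apply: le_trans (sqrt_sum_sqrD _ _).
by rewrite ler_wsqrtr //; apply: ler_sum => j _; rewrite addrA subrK.
Qed.

Lemma dH_triangle u v w : dH u w <= dH u v + dH v w.
Proof.
apply: le_trans (sqrt_sum_sqrD _ _).
by rewrite ler_wsqrtr //; apply: ler_sum => j _; rewrite addrA subrK.
Qed.

End Triangle.

(** * Effect of the contamination on the mean *)

Section Contamination.
Context {R : realType} {n k : nat}.
Implicit Types x y : n.-tuple (k.-tuple R).

(** What adversarial contamination guarantees on a single outcome. *)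
Definition contaminated (eps : R) x y : Prop :=
  [/\ forall i, simplex (tnth x i), forall i, simplex (tnth y i) &
      exists2 O : {set 'I_n}, #|O|%:R <= n%:R * eps &
        forall i, i \notin O -> tnth x i = tnth y i].

Lemma tnth_sample_mean x j :
  tnth (sample_mean x) j = n%:R^-1 * \sum_(i < n) tnth (tnth x i) j.
Proof. by rewrite tnth_mktuple. Qed.

Lemma sample_mean_ge0 x j : (forall i, simplex (tnth x i)) ->
  0 <= tnth (sample_mean x) j.
Proof.
move=> sx; rewrite tnth_sample_mean mulr_ge0 ?invr_ge0 // sumr_ge0 // => i _.
by have [] := sx i.
Qed.

Lemma simplex_le1 (v : k.-tuple R) j : simplex v -> tnth v j <= 1.
Proof.
by move=> [v0 <-]; rewrite (bigD1 j) //= lerDl sumr_ge0.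
Qed.

Variables (eps : R) (x y : n.-tuple (k.-tuple R)).
Hypotheses (n0 : (0 < n)%N) (xy : contaminated eps x y).

(** The two parts are the contributions to the means of the modified indices:
    the other indices cancel, and each point of the simplex has total mass
    one. *)
Lemma mean_split : exists a b : 'I_k -> R,
  [/\ forall j, 0 <= a j, forall j, 0 <= b j,
      forall j, tnth (sample_mean x) j - tnth (sample_mean y) j = a j - b j,
      \sum_j a j <= eps & \sum_j b j <= eps].
Proof.
have [sx sy [S Seps Sxy]] := xy.
have n0' : 0 < n%:R :> R by rewrite ltr0n.
pose part (w : n.-tuple (k.-tuple R)) j := n%:R^-1 * \sum_(i in S) tnth (tnth w i) j.
have part0 w j : (forall i, simplex (tnth w i)) -> 0 <= part w j.
  move=> sw; rewrite mulr_ge0 ?invr_ge0 // sumr_ge0 // => i _.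
  by have [] := sw i.
have partS w : (forall i, simplex (tnth w i)) -> \sum_j part w j <= eps.
  move=> sw; rewrite -mulr_sumr exchange_big /= (eq_bigr (fun=> 1)) => [|i _].
    by rewrite sumr_const ler_pdivrMl.
  by have [] := sw i.
exists (part x), (part y); split; try (by move=> j; exact: part0); try exact: partS.
move=> j; rewrite !tnth_sample_mean /part.
rewrite (bigID (mem S)) /= [in X in _ - X](bigID (mem S)) /=.
rewrite [in X in _ - X](eq_bigr (fun i => tnth (tnth x i) j) (P := fun i => i \notin S)).
  by ring.
by move=> i iS; rewrite Sxy.
Qed.

Let sum_dist :
  \sum_j `|tnth (sample_mean x) j - tnth (sample_mean y) j| <= 2 * eps.
Proof.
have [a [b [a0 b0 abE sa sb]]] := mean_split.
apply: (@le_trans _ _ (\sum_j (a j + b j))).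
  apply: ler_sum => j _; rewrite abE (le_trans (ler_normB _ _)) //.
  by rewrite !ger0_norm.
by rewrite big_split /= mulr_natl mulr2n lerD.
Qed.

Lemma dTV_contaminated : dTV (sample_mean x) (sample_mean y) <= eps.
Proof. by rewrite /dTV ler_pdivrMl. Qed.

(** The cross terms of [(a j - b j)^2] are nonpositive, and the sum of the
    squares of nonnegative numbers is at most the square of their sum. *)
Lemma dL2_contaminated :
  dL2 (sample_mean x) (sample_mean y) <= Num.sqrt 2 * eps.
Proof.
have [a [b [a0 b0 abE sa sb]]] := mean_split.
have eps0 : 0 <= eps by apply: le_trans sa; exact: sumr_ge0.
have sq (c : 'I_k -> R) : (forall j, 0 <= c j) -> \sum_j c j <= eps ->
    \sum_j c j ^+ 2 <= eps ^+ 2.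
  move=> c0 sc; rewrite expr2; apply: le_trans (ler_wpM2r eps0 sc).
  rewrite mulr_suml; apply: ler_sum => j _; rewrite expr2 ler_wpM2l //.
  by apply: le_trans sc; rewrite (bigD1 j) //= lerDl sumr_ge0.
apply: ler_sqrt_sqr; first by rewrite mulr_ge0.
rewrite exprMn sqr_sqrtr // mulr_natl mulr2n.
apply: le_trans (lerD (sq a a0 sa) (sq b b0 sb)).
rewrite -big_split; apply: ler_sum => j _ /=.
by rewrite abE; have := a0 j; have := b0 j; nra.
Qed.

Lemma dH_contaminated :
  dH (sample_mean x) (sample_mean y) <= 2 * Num.sqrt eps.
Proof.
have [a [b [a0 b0 abE sa sb]]] := mean_split.
have eps0 : 0 <= eps by apply: le_trans sa; exact: sumr_ge0.
have [sx sy _] := xy.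
apply: ler_sqrt_sqr; first by rewrite mulr_ge0.
rewrite exprMn sqr_sqrtr //.
apply: (@le_trans _ _ (2 * eps)); last by nra.
apply: le_trans sum_dist; apply: ler_sum => j _.
by apply: sqr_sub_sqrt; exact: sample_mean_ge0.
Qed.
End Contamination.

(** * Quadratic upper bounds around a sparse parameter *)

Section SparseBounds.
Context {R : realType} {k : nat}.
Variables (s : nat) (theta u : k.-tuple R) (c : R).
Hypotheses (s0 : (0 < s)%N) (c0 : 0 < c).
Hypothesis theta_sparse : sparse_simplex s theta.
Hypothesis u0 : forall j, 0 <= tnth u j.

Lemma sum_support_le (a : R) : 0 <= a ->
  \sum_j (if tnth theta j == 0 then 0 else a) <= s%:R * a.
Proof.
move=> a0; have [_ card_s] := theta_sparse.
under eq_bigr do rewrite -[X in if X then _ else _]negbK if_neg.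
by rewrite -big_mkcond /= sumr_const -[leLHS]mulr_natl ler_wpM2r // ler_nat.
Qed.

(** On the support, [le_half_sqr] is applied to each coordinate at the scale
    [c / s], so that the constant terms add up to a multiple of [c]. *)
Lemma dTV_sparse_le :
  dTV u theta <= 4^-1 * c + \sum_j
    ((if tnth theta j == 0 then 0 else 4^-1 * (s%:R / c)) *
       (tnth u j - tnth theta j) ^+ 2
     + (if tnth theta j == 0 then 2^-1 else 0) * tnth u j).
Proof.
have s0' : 0 < s%:R :> R by rewrite ltr0n.
apply: (@le_trans _ _ (\sum_j ((if tnth theta j == 0 then 0 else 4^-1 * (c / s%:R)) +
    ((if tnth theta j == 0 then 0 else 4^-1 * (s%:R / c)) *
       (tnth u j - tnth theta j) ^+ 2
     + (if tnth theta j == 0 then 2^-1 else 0) * tnth u j)))).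
  rewrite /dTV mulr_sumr; apply: ler_sum => j _; case: eqP => [->|_].
    by rewrite mul0r !add0r subr0 ger0_norm.
  rewrite mul0r addr0.
  have := le_half_sqr `|tnth u j - tnth theta j| (divr_gt0 c0 s0').
  rewrite real_normK ?num_real // => /(ler_wpM2l (x := 2^-1)).
  rewrite invr_ge0 => /(_ (ler0n _ _)) /le_trans; apply.
  rewrite [leLHS](_ : _ = 4^-1 * (c / s%:R) +
    4^-1 * (s%:R / c) * (tnth u j - tnth theta j) ^+ 2) //.
  by field; rewrite !gt_eqF.
rewrite big_split lerD2r /=; apply: le_trans (sum_support_le _) _.
  by rewrite mulr_ge0 ?invr_ge0 // divr_ge0 // ltW.
by rewrite [leLHS](_ : _ = 4^-1 * c) //; field; rewrite gt_eqF.
Qed.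

(** On the support, dividing by [theta_j] normalises every coordinate, whose
    expected square is at most [theta_j / n], to a contribution [1 / n].  Off
    the support the weight [theta_j^-1] is zero, as the inverse of zero is zero,
    and [(sqrt u_j - 0)^2 = u_j]. *)
Lemma dH_sparse_le :
  dH u theta <= 2^-1 * c + \sum_j
    ((2 * c)^-1 * (tnth theta j)^-1 * (tnth u j - tnth theta j) ^+ 2
     + (if tnth theta j == 0 then (2 * c)^-1 else 0) * tnth u j).
Proof.
have [[theta0 _] _] := theta_sparse.
apply: le_trans (le_half_sqr _ c0) _.
rewrite mulrDr lerD2l sqr_sqrtr; last by apply: sumr_ge0 => j _; exact: sqr_ge0.
rewrite mulr_suml mulr_sumr; apply: ler_sum => j _.
have -> (a : R) : 2^-1 * (a / c) = (2 * c)^-1 * a.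
  by field; rewrite gt_eqF.
case: eqP => [->|/eqP tj].
  by rewrite invr0 mulr0 mul0r add0r sqrtr0 subr0 sqr_sqrtr.
rewrite mul0r addr0 -mulrA ler_wpM2l //.
  by rewrite invr_ge0 mulr_ge0 // ltW.
by rewrite [leRHS]mulrC sqr_sub_sqrt_pos // lt0r tj theta0.
Qed.

Lemma dL2_le :
  dL2 u theta <= 2^-1 * c + \sum_j
    ((2 * c)^-1 * (tnth u j - tnth theta j) ^+ 2 + 0 * tnth u j).
Proof.
apply: le_trans (le_half_sqr _ c0) _.
rewrite mulrDr lerD2l sqr_sqrtr; last by apply: sumr_ge0 => j _; exact: sqr_ge0.
rewrite mulr_suml mulr_sumr; apply: ler_sum => j _.
rewrite mul0r addr0 [leLHS](_ : _ = (2 * c)^-1 * (tnth u j - tnth theta j) ^+ 2) //.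
by field; rewrite gt_eqF.
Qed.
End SparseBounds.

(** * From outcomes to the worst-case risk *)

Section Measurability.
Context {R : realType} {n k : nat}.
Implicit Types (theta : k.-tuple R).

Lemma measurable_sample_mean j : measurable_fun [set: n.-tuple (k.-tuple R)]
  (fun x => tnth (sample_mean x) j).
Proof.
under eq_fun do rewrite tnth_sample_mean.
apply: measurable_funM => //; apply: measurable_sum => i.
exact: measurableT_comp (measurable_tnth j) (measurable_tnth i).
Qed.

Lemma measurable_sqrt : measurable_fun [set: R] Num.sqrt.
Proof. by apply: continuous_measurable_fun; exact: sqrt_continuous. Qed.

Lemma measurable_dTV theta : measurable_fun [set: n.-tuple (k.-tuple R)]
  (fun x => dTV (sample_mean x) theta).
Proof.
apply: measurable_funM => //; apply: measurable_sum => j.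
apply: measurableT_comp => //; apply: measurable_funB => //.
exact: measurable_sample_mean.
Qed.

Lemma measurable_dH theta : measurable_fun [set: n.-tuple (k.-tuple R)]
  (fun x => dH (sample_mean x) theta).
Proof.
apply: (measurableT_comp measurable_sqrt); apply: measurable_sum => j.
apply: measurable_funX; apply: measurable_funB => //.
exact: measurableT_comp measurable_sqrt (measurable_sample_mean j).
Qed.

Lemma measurable_dL2 theta : measurable_fun [set: n.-tuple (k.-tuple R)]
  (fun x => dL2 (sample_mean x) theta).
Proof.
apply: (measurableT_comp measurable_sqrt); apply: measurable_sum => j.
by apply: measurable_funX; apply: measurable_funB => //; exact: measurable_sample_mean.
Qed.
End Measurability.

Section Risk.
Context {R : realType} {k n : nat} (n0 : (0 < n)%N) (eps : R).
Implicit Types (theta : k.-tuple R).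

(** A bound on each outcome that is affine in the squared errors and the
    coordinates of the clean mean passes to expectations, whatever the
    dependence of the contamination on the sample. *)
Lemma AC_expectation_le theta (Pn : probability (n.-tuple (k.-tuple R)) R)
    (f : n.-tuple (k.-tuple R) -> R) (A : R) (alpha beta : 'I_k -> R) :
  AC_model n eps theta Pn ->
  measurable_fun setT f -> (forall x, 0 <= f x) ->
  0 <= A -> (forall j, 0 <= alpha j) -> (forall j, 0 <= beta j) ->
  (forall x y, contaminated eps x y ->
    f x <= A + \sum_j (alpha j * (tnth (sample_mean y) j - tnth theta j) ^+ 2 +
                       beta j * tnth (sample_mean y) j)) ->
  ('E_Pn[f] <= (A + \sum_j (alpha j * (tnth theta j / n%:R) +
                            beta j * tnth theta j))%:E)%E.
Proof.
move=> [d [T [P [Q [Y [X [S [[_ mean] YQ [simp _ [m meps Sm] XY] PnX]]]]]]]].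
move=> mf f0 A0 a0 b0 fle.
have cont t : contaminated eps (X t) (Y t).
  split; try by move=> i; have [] := simp t i.
  by exists (S t); [rewrite Sm | exact: XY].
have meas j (t : R -> R) : measurable_fun setT t ->
    measurable_fun setT (fun w => (t (tnth (sample_mean (Y w)) j))%:E).
  move=> mt; apply/measurable_EFinP; apply: (measurableT_comp mt).
  exact: measurableT_comp (measurable_sample_mean j) (measurable_funPT Y).
pose sq j t := ((tnth (sample_mean (Y t)) j - tnth theta j) ^+ 2)%:E.
pose mn j t := (tnth (sample_mean (Y t)) j)%:E.
have msq j : measurable_fun setT (sq j).
  apply: (meas j (fun r => (r - tnth theta j) ^+ 2)).
  by apply: measurable_funX; exact: measurable_funB.
have mmn j : measurable_fun setT (mn j) by exact: (meas j id).
have sq0 j t : (0 <= sq j t)%E by rewrite lee_fin sqr_ge0.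
have mn0 j t : (0 <= mn j t)%E.
  by rewrite lee_fin sample_mean_ge0 // => i; have [] := simp t i.
have masq j : measurable_fun setT (fun t => (alpha j)%:E * sq j t)%E.
  exact: measurable_funeM.
have mbmn j : measurable_fun setT (fun t => (beta j)%:E * mn j t)%E.
  exact: measurable_funeM.
have asq0 j t : (0 <= (alpha j)%:E * sq j t)%E by rewrite mule_ge0 // lee_fin.
have bmn0 j t : (0 <= (beta j)%:E * mn j t)%E by rewrite mule_ge0 // lee_fin.
have h01 j i t : 0 <= tnth (tnth (Y t) i) j <= 1.
  have [_ _] := cont t.
  by have [sy _] := simp t i; rewrite simplex_le1 // andbT; case: sy.
(* The coordinate [j] of the points is the statistic to which the mean-square
   bound applies; it lies in [0, 1] along the sample but not on all vectors. *)
have Esq j : (\int[P]_t sq j t <= (tnth theta j / n%:R)%:E)%E.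
  have := iid_mean_square_error YQ (measurable_tnth j) (mean j) (h01 j) n0.
  by rewrite /sq; under [X in _ -> (X <= _)%E]eq_integral do rewrite tnth_sample_mean.
have Emn j : (\int[P]_t mn j t = (tnth theta j)%:E)%E.
  have := iid_mean_expectation YQ (measurable_tnth j) (mean j) (h01 j) n0.
  by rewrite /mn; under [X in _ -> X = _]eq_integral do rewrite tnth_sample_mean.
rewrite unlock (eq_measure_integral (distribution P X)) => [|B mB _]; last exact: PnX.
rewrite ge0_integral_distribution //; last exact/measurable_EFinP.
apply: (@le_trans _ _
  (\int[P]_t (A%:E + \sum_j ((alpha j)%:E * sq j t + (beta j)%:E * mn j t)))%E).
  apply: ge0_le_integral => //=.
  - by move=> t _; rewrite lee_fin.
  - by apply/measurable_EFinP; exact: measurableT_comp mf (measurable_funPT X).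
  - apply: emeasurable_funD => //; apply: emeasurable_sum => j.
    exact: emeasurable_funD.
  - move=> t _; apply: (@le_trans _ _ (A + \sum_j (alpha j *
      (tnth (sample_mean (Y t)) j - tnth theta j) ^+ 2 +
        beta j * tnth (sample_mean (Y t)) j))%:E).
      by rewrite lee_fin; exact: fle.
    by rewrite EFinD -sumEFin.
rewrite ge0_integralD //; last 2 first.
- by move=> t _; apply: sume_ge0 => j _; exact: adde_ge0.
- by apply: emeasurable_sum => j; exact: emeasurable_funD.
rewrite integral_probability_cst EFinD leeD2l // -sumEFin.
rewrite ge0_integral_sum //; last 2 first.
- by move=> j; exact: emeasurable_funD.
- by move=> j t _; exact: adde_ge0.
apply: lee_sum => j _; rewrite ge0_integralD //.
rewrite !ge0_integralZl_EFin // EFinD !EFinM leeD //.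
  by rewrite -EFinM lee_wpmul2l // lee_fin.
by rewrite Emn.
Qed.

(** Separates the two sources of error: [delta] accounts for the contamination
    and [B] for the sampling fluctuations of the clean mean. *)
Lemma AC_risk_le (dist : k.-tuple R -> k.-tuple R -> R)
    (Theta : set (k.-tuple R)) (delta A B : R) (alpha beta : k.-tuple R -> 'I_k -> R) :
  (forall theta, measurable_fun [set: n.-tuple (k.-tuple R)]
     (fun x => dist (sample_mean x) theta)) ->
  (forall u v, 0 <= dist u v) ->
  (forall u v w, dist u w <= dist u v + dist v w) ->
  (forall x y : n.-tuple (k.-tuple R), contaminated eps x y ->
     dist (sample_mean x) (sample_mean y) <= delta) ->
  0 <= delta -> 0 <= A ->
  (forall theta, Theta theta ->
   [/\ forall j, 0 <= alpha theta j,
       forall j, 0 <= beta theta j,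
       forall u, (forall j, 0 <= tnth u j) -> dist u theta <=
         A + \sum_j (alpha theta j * (tnth u j - tnth theta j) ^+ 2 +
                     beta theta j * tnth u j) &
       A + \sum_j (alpha theta j * (tnth theta j / n%:R) +
                   beta theta j * tnth theta j) <= B]) ->
  (AC_risk dist n eps Theta (@sample_mean R k n) <= (B + delta)%:E)%E.
Proof.
move=> mdist dist0 tri cont delta0 A0 clean.
apply: ge_ereal_sup => _ [theta /clean[a0 b0 cle cB] <-].
apply: ge_ereal_sup => _ [Pn PnAC <-].
apply: le_trans (AC_expectation_le (A := delta + A) PnAC (mdist theta) _ _ a0 b0 _) _.
- by move=> x; exact: dist0.
- exact: addr_ge0.
- move=> x y xy; apply: le_trans (tri _ (sample_mean y) _) _.
  rewrite -addrA lerD ?cont // cle // => j.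
  by apply: sample_mean_ge0; case: xy.
- by rewrite lee_fin -addrA addrC lerD2r.
Qed.
End Risk.

Theorem theorem1 (R : realType) (k s n : nat) (eps : R)
    (k_gt0 : (0 < k)%N) (s_gt0 : (0 < s)%N) (n_gt0 : (0 < n)%N)
    (eps01 : 0 <= eps <= 1) :
  [/\ (AC_risk (@dTV R k) n eps (sparse_simplex s) (@sample_mean R k n)
        <= (Num.sqrt (s%:R / n%:R) + 2 * eps)%:E)%E,
      (AC_risk (@dH R k) n eps (sparse_simplex s) (@sample_mean R k n)
        <= (Num.sqrt (s%:R / n%:R) + 2 * Num.sqrt eps)%:E)%E
    & (AC_risk (@dL2 R k) n eps (sparse_simplex s) (@sample_mean R k n)
        <= (Num.sqrt (1 / n%:R) + Num.sqrt 2 * eps)%:E)%E].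
Proof.
have /andP[eps0 _] := eps01.
have s0 : 0 < s%:R :> R by rewrite ltr0n.
have n0 : 0 < n%:R :> R by rewrite ltr0n.
have c0 : 0 < Num.sqrt (s%:R / n%:R) :> R by rewrite sqrtr_gt0 divr_gt0.
have cE : Num.sqrt (s%:R / n%:R) ^+ 2 = s%:R / n%:R :> R.
  by rewrite sqr_sqrtr // divr_ge0 // ltW.
have e0 : 0 < Num.sqrt (1 / n%:R) :> R by rewrite sqrtr_gt0 divr_gt0.
have eE : Num.sqrt (1 / n%:R) ^+ 2 = 1 / n%:R :> R.
  by rewrite sqr_sqrtr // divr_ge0 // ltW.
set c : R := Num.sqrt (s%:R / n%:R) in c0 cE *.
set e : R := Num.sqrt (1 / n%:R) in e0 eE *.
split.
(* Total variation: as [s / (n * c) = c], the constant part and the variance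
   part are each [c / 4]. *)
- apply: (AC_risk_le n_gt0 (A := 4^-1 * c)
    (alpha := fun theta j => if tnth theta j == 0 then 0 else 4^-1 * (s%:R / c))
    (beta := fun theta j => if tnth theta j == 0 then 2^-1 else 0)).
  + exact: measurable_dTV.
  + by move=> u v; rewrite mulr_ge0 ?invr_ge0 // sumr_ge0.
  + exact: dTV_triangle.
  + move=> x y /(dTV_contaminated n_gt0)/le_trans; apply.
    by rewrite mulr_natl mulr2n lerDl.
  + by rewrite mulr_ge0.
  + by rewrite mulr_ge0 ?invr_ge0 // ltW.
  + move=> theta sp; have [[theta0 theta1] _] := sp; split.
    * move=> j; case: ifP => // _.
      by rewrite mulr_ge0 ?invr_ge0 // divr_ge0 // ltW.
    * by move=> j; case: ifP => // _; rewrite invr_ge0.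
    * by move=> u u0; exact: dTV_sparse_le.
    * apply: (@le_trans _ _ (4^-1 * c + \sum_j tnth theta j *
        (4^-1 * (s%:R / c) / n%:R))).
        rewrite lerD2l; apply: ler_sum => j _; case: eqP => [->|_].
          by rewrite !mul0r mulr0 addr0.
        by rewrite mul0r addr0 mulrCA mulrA.
      rewrite -mulr_suml theta1 mul1r.
      have -> : 4^-1 * (s%:R / c) / n%:R = 4^-1 * c.
        have -> : 4^-1 * (s%:R / c) / n%:R = 4^-1 * (s%:R / n%:R) / c.
          by field; rewrite !gt_eqF.
        by rewrite -cE; field; rewrite gt_eqF.
      by lra.
(* Hellinger: each coordinate of the support contributes [1 / n], in total at
   most [s / n = c^2]. *)
- apply: (AC_risk_le n_gt0 (A := 2^-1 * c)
    (alpha := fun theta j => (2 * c)^-1 * (tnth theta j)^-1)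
    (beta := fun theta j => if tnth theta j == 0 then (2 * c)^-1 else 0)).
  + exact: measurable_dH.
  + by move=> u v; exact: sqrtr_ge0.
  + exact: dH_triangle.
  + by move=> x y; exact: dH_contaminated.
  + by rewrite mulr_ge0.
  + by rewrite mulr_ge0 ?invr_ge0 // ltW.
  + have c20 : 0 <= (2 * c)^-1 by rewrite invr_ge0 mulr_ge0 // ltW.
    move=> theta sp; have [[theta0 theta1] _] := sp; split.
    * by move=> j; rewrite mulr_ge0 // invr_ge0.
    * by move=> j; case: ifP.
    * by move=> u u0; exact: dH_sparse_le.
    * apply: (@le_trans _ _ (2^-1 * c + \sum_j
        (if tnth theta j == 0 then 0 else (2 * c)^-1 / n%:R))).
        rewrite lerD2l; apply: ler_sum => j _; case: eqP => [->|/eqP tj].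
          by rewrite !mul0r !mulr0 addr0.
        rewrite mul0r addr0 [leLHS](_ : _ = (2 * c)^-1 / n%:R) //.
        by field; rewrite tj !gt_eqF.
      apply: (@le_trans _ _ (2^-1 * c + s%:R * ((2 * c)^-1 / n%:R))).
        rewrite lerD2l; apply: (sum_support_le sp).
        by rewrite divr_ge0 // ltW.
      have -> : s%:R * ((2 * c)^-1 / n%:R) = 2^-1 * c.
        have -> : s%:R * ((2 * c)^-1 / n%:R) = 2^-1 * (s%:R / n%:R) / c.
          by field; rewrite !gt_eqF.
        by rewrite -cE; field; rewrite gt_eqF.
      by lra.
(* Euclidean norm: the variances sum to at most [1 / n] because the [theta_j] sum to
   one, whatever the sparsity. *)
- apply: (AC_risk_le n_gt0 (A := 2^-1 * e)
    (alpha := fun _ _ => (2 * e)^-1) (beta := fun _ _ => 0)).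
  + exact: measurable_dL2.
  + by move=> u v; exact: sqrtr_ge0.
  + exact: dL2_triangle.
  + by move=> x y; exact: dL2_contaminated.
  + by rewrite mulr_ge0.
  + by rewrite mulr_ge0 ?invr_ge0 // ltW.
  + move=> theta sp; have [[theta0 theta1] _] := sp; split => //.
    * by move=> j; rewrite invr_ge0 mulr_ge0 // ltW.
    * by move=> u u0; exact: dL2_le.
    * under eq_bigr do rewrite mul0r addr0.
      rewrite -mulr_sumr -mulr_suml theta1.
      have -> : (2 * e)^-1 * (1 / n%:R) = 2^-1 * e.
        by rewrite -eE; field; rewrite gt_eqF.
      by lra.
Qed.
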